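(* Let $\mathcal{C}$ be a category and let $D$ be a collection of sieves in $\mathcal{C}$ which is closed under pullback (write $D(c)$ for the sieves in $D$ on the object $c$; if $S\in D(c)$ and $f:d\to c$ then $f^{*}(S)\in D(d)$). Let $D^{l}$ and $D^{r}$ be the collections of sieves defined in the context. Then $D^{l}$ is a Grothendieck topology on $\mathcal{C}$, and $(D^{r})^{l}$ is the Grothendieck topology on $\mathcal{C}$ generated by $D$, i.e. the smallest Grothendieck topology on $\mathcal{C}$ for which all the sieves in $D$ are covering. Explicitly, a sieve $S$ on $c$ is covering for the Grothendieck topology generated by $D$ if and only if for any arrow $f:d\to c$ and any sieve $T$ on $d$: if $f^{*}(S)\subseteq T$ and, for any arrow $g:e\to d$ and any sieve $Z$ on $e$, ($Z\in D(e)$ and $Z\subseteq g^{*}(T)$) implies $g\in T$, then $T=M_d$.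
   Context: $M_d$ denotes the maximal sieve on $d$. For a sieve $S$ on $c$ and $f:d\to c$, $f^{*}(S)=\{g \mid \mathrm{cod}(g)=d,\ f\circ g\in S\}$. For a collection $D$ of sieves closed under pullback, define for each object $c$: $D^{r}(c)=\{T$ sieve on $c \mid$ for any arrow $f:d\to c$ and sieve $S$ on $d$, [$S\in D(d)$ and $S\subseteq f^{*}(T)$] implies $f\in T\}$; $D^{l}(c)=\{S$ sieve on $c\mid$ for any arrow $f:d\to c$ and sieve $Z$ on $d$, [$Z\in D(d)$ and $f^{*}(S)\subseteq Z$] implies $Z=M_d\}$. *)

(* Defs.v *)
Declare Scope cat_scope.
Delimit Scope cat_scope with cat.

Record category : Type := Category {
  Ob :> Type;
  Hom : Ob -> Ob -> Type;
  idm : forall c : Ob, Hom c c;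
  comp : forall e d c : Ob, Hom d c -> Hom e d -> Hom e c;
  comp_idl : forall (d c : Ob) (f : Hom d c), comp d c c (idm c) f = f;
  comp_idr : forall (d c : Ob) (f : Hom d c), comp d d c f (idm d) = f;
  comp_assoc : forall (b e d c : Ob) (f : Hom d c) (g : Hom e d) (h : Hom b e),
    comp b d c f (comp b e d g h) = comp b e c (comp e d c f g) h
}.

Arguments Hom {_} _ _.
Arguments idm {_} _.
Arguments comp {_} {e d c} _ _.

Notation "f ∘ g" := (comp f g)
  (at level 40, left associativity) : cat_scope.
Local Open Scope cat_scope.

(* Under functional and propositional extensionality and proof irrelevance,
   Leibniz equality of sieves is equality of the underlying sets of arrows. *)
Record sieve {C : category} (c : C) : Type := Sieve {
  arrows : forall d : C, Hom d c -> Prop;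
  arrows_closed : forall (d e : C) (f : Hom d c) (g : Hom e d),
    arrows d f -> arrows e (f ∘ g)
}.

Arguments Sieve {C c} arrows arrows_closed.
Arguments arrows {C c} s d _.
Arguments arrows_closed {C c} s {d e} f g _.

Definition mem_sieve {C : category} {d c : C} (f : Hom d c) (S : sieve c) : Prop :=
  arrows S d f.

Definition sub_sieve {C : category} {c : C} (S T : sieve c) : Prop :=
  forall (d : C) (f : Hom d c), mem_sieve f S -> mem_sieve f T.

Notation "f '\in_s' S" := (mem_sieve f S) (at level 70, no associativity) : cat_scope.
Notation "S '\sub_s' T" := (sub_sieve S T) (at level 70, no associativity) : cat_scope.

Definition max_sieve {C : category} (c : C) : sieve c :=
  Sieve (fun (d : C) (_ : Hom d c) => True) (fun _ _ _ _ _ => I).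

Lemma pullback_closed {C : category} {d c : C} (f : Hom d c) (S : sieve c)
    (e b : C) (g : Hom e d) (h : Hom b e) :
  f ∘ g \in_s S -> f ∘ (g ∘ h) \in_s S.
Proof. rewrite comp_assoc; apply arrows_closed. Qed.

Definition pullback {C : category} {d c : C} (f : Hom d c) (S : sieve c) : sieve d :=
  Sieve (fun (e : C) (g : Hom e d) => f ∘ g \in_s S) (pullback_closed f S).

Definition sieve_collection (C : category) : Type := forall c : C, sieve c -> Prop.

Definition pullback_stable {C : category} (D : sieve_collection C) : Prop :=
  forall (d c : C) (f : Hom d c) (S : sieve c), D c S -> D d (pullback f S).

Definition sub_collection {C : category} (D E : sieve_collection C) : Prop :=
  forall (c : C) (S : sieve c), D c S -> E c S.

Definition right_orth {C : category} (D : sieve_collection C) : sieve_collection C :=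
  fun (c : C) (T : sieve c) =>
    forall (d : C) (f : Hom d c) (S : sieve d),
      D d S /\ S \sub_s pullback f T -> f \in_s T.

Definition left_orth {C : category} (D : sieve_collection C) : sieve_collection C :=
  fun (c : C) (S : sieve c) =>
    forall (d : C) (f : Hom d c) (Z : sieve d),
      D d Z /\ pullback f S \sub_s Z -> Z = max_sieve d.

Record is_topology {C : category} (J : sieve_collection C) : Prop := IsTopology {
  topology_max : forall c : C, J c (max_sieve c);
  topology_stable : pullback_stable J;
  topology_trans : forall (c : C) (S R : sieve c),
    J c S ->
    (forall (d : C) (f : Hom d c), f \in_s S -> J d (pullback f R)) ->
    J c R
}.

Record is_generated_topology {C : category} (D J : sieve_collection C) : Prop :=
  IsGeneratedTopology {
  generated_topology : is_topology J;
  generated_contains : sub_collection D J;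
  generated_least : forall K : sieve_collection C,
    is_topology K -> sub_collection D K -> sub_collection J K
}.

(* So the left orthogonal in [left_orth (right_orth D)] is taken of a
   pullback-stable collection. *)
Lemma right_orth_stable {C : category} (D : sieve_collection C) :
  pullback_stable (right_orth D).
Proof.
intros d c f T HT e g S [HS Hsub].
apply (HT e (f ∘ g) S); split; [exact HS|].
intros b h Hh; unfold mem_sieve; simpl.
rewrite <- comp_assoc; exact (Hsub b h Hh).
Qed.

(* Main.v *)
(** For a Grothendieck topology [K] containing [D], the [K]-closure of a sieve
    [S], i.e. the sieve of those [f] with [f^*(S)] in [K], contains [S] and lies in
    [D^r]. If [S] is in [(D^r)^l], its [K]-closure is therefore maximal; it
    contains the identity, which says that [S] is [K]-covering. *)

From Stdlib Require Import FunctionalExtensionality PropExtensionality ProofIrrelevance.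
Require Import Defs.

Local Open Scope cat_scope.

Section Sieves.

Variable C : category.

(** [left_orth] asks for Leibniz equality with the maximal sieve, so mutual inclusion has to be
    turned into equality. *)
Lemma sieve_ext (c : C) (S T : sieve c) : S \sub_s T -> T \sub_s S -> S = T.
Proof.
intros ST TS.
destruct S as [A HA], T as [B HB].
assert (E : A = B).
{ extensionality d; extensionality f.
  apply propositional_extensionality; split; [apply ST | apply TS]. }
subst B; f_equal; apply proof_irrelevance.
Qed.

Lemma sieve_max_of_id (c : C) (S : sieve c) : idm c \in_s S -> S = max_sieve c.
Proof.
intros Hid; apply sieve_ext; intros d f Hf; [exact I|].
rewrite <- (comp_idl _ _ _ f); apply arrows_closed; exact Hid.
Qed.

Lemma pullback_mem (d c : C) (f : Hom d c) (S : sieve c) :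
  f \in_s S -> pullback f S = max_sieve d.
Proof.
intros Hf; apply sieve_max_of_id.
unfold mem_sieve; simpl; rewrite comp_idr; exact Hf.
Qed.

Lemma mem_of_pullback_max (d c : C) (f : Hom d c) (S : sieve c) :
  pullback f S = max_sieve d -> f \in_s S.
Proof.
intros E.
assert (H : idm d \in_s pullback f S) by (rewrite E; exact I).
unfold mem_sieve in H; simpl in H; rewrite comp_idr in H; exact H.
Qed.

Lemma pullback_idm (c : C) (S : sieve c) : pullback (idm c) S = S.
Proof.
apply sieve_ext; intros d f; unfold mem_sieve; simpl; rewrite comp_idl; exact (fun H => H).
Qed.

Lemma pullback_comp (e d c : C) (f : Hom d c) (g : Hom e d) (S : sieve c) :
  pullback (f ∘ g) S = pullback g (pullback f S).
Proof.
apply sieve_ext; intros b h; unfold mem_sieve; simpl; unfold mem_sieve; simpl;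
  rewrite comp_assoc; exact (fun H => H).
Qed.

Lemma pullback_sub (d c : C) (f : Hom d c) (S T : sieve c) :
  S \sub_s T -> pullback f S \sub_s pullback f T.
Proof. intros ST e g; exact (ST e (f ∘ g)). Qed.

Lemma left_orth_topology (D : sieve_collection C) :
  pullback_stable D -> is_topology (left_orth D).
Proof.
intros D_stable; constructor.
- intros c d f Z [_ Hsub]; apply sieve_max_of_id, Hsub; exact I.
- intros d c f S HS e g Z HZ.
  apply (HS e (f ∘ g)); rewrite pullback_comp; exact HZ.
- intros c S R HS HR d f Z [HZ Hsub].
  apply (HS d f); split; [exact HZ|].
  (* To see that f^*(S) is contained in Z, take g in f^*(S). By stability g^*(Z) lies in D, and it
     contains (f ∘ g)^*(R), so [HR] at the identity makes it maximal, which says that g is in Z. *)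
  intros e g Hg; apply mem_of_pullback_max.
  apply (HR e (f ∘ g) Hg e (idm e)); split; [apply D_stable, HZ|].
  rewrite pullback_idm, pullback_comp; apply pullback_sub, Hsub.
Qed.

(** If S is in D, so is f^*(S). A sieve Z in D^r containing f^*(S) then contains the identity, by
    the condition defining D^r taken at the identity arrow. *)
Lemma sub_left_right_orth (D : sieve_collection C) :
  pullback_stable D -> sub_collection D (left_orth (right_orth D)).
Proof.
intros D_stable c S HS d f Z [HZ Hsub].
apply sieve_max_of_id, (HZ d (idm d) (pullback f S)).
rewrite pullback_idm; split; [apply D_stable, HS | exact Hsub].
Qed.

Lemma closure_closed (K : sieve_collection C) (HK : is_topology K) (c : C)
    (S : sieve c) (d e : C) (f : Hom d c) (g : Hom e d) :
  K d (pullback f S) -> K e (pullback (f ∘ g) S).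
Proof. rewrite pullback_comp; apply topology_stable, HK. Qed.

Definition closure (K : sieve_collection C) (HK : is_topology K) (c : C)
    (S : sieve c) : sieve c :=
  Sieve (fun (d : C) (f : Hom d c) => K d (pullback f S)) (closure_closed K HK c S).

Lemma sub_closure (K : sieve_collection C) (HK : is_topology K) (c : C)
    (S : sieve c) : S \sub_s closure K HK c S.
Proof.
intros d f Hf; unfold mem_sieve; simpl.
rewrite (pullback_mem _ _ f S Hf); apply topology_max, HK.
Qed.

(** When a K-covering W is contained in the pullback along f of the closure, f^*(S) is K-covering
    after pullback along each arrow of W. Transitivity makes f^*(S) itself K-covering. *)
Lemma closure_right_orth (K : sieve_collection C) (HK : is_topology K) (c : C)
    (S : sieve c) : right_orth K c (closure K HK c S).
Proof.
intros d f W [HW Hsub].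
apply (topology_trans K HK d W); [exact HW|].
intros e g Hg; rewrite <- pullback_comp; exact (Hsub e g Hg).
Qed.

Lemma right_orth_anti (D E : sieve_collection C) :
  sub_collection D E -> sub_collection (right_orth E) (right_orth D).
Proof.
intros DE c T HT d f S [HS Hsub]; apply (HT d f S); split; [apply DE, HS | exact Hsub].
Qed.

Lemma left_right_orth_least (D K : sieve_collection C) :
  is_topology K -> sub_collection D K ->
  sub_collection (left_orth (right_orth D)) K.
Proof.
intros HK DK c S HS.
(* Writing S as its pullback along the identity makes the goal convertible to membership of the
   identity in the closure. *)
rewrite <- pullback_idm.
change (idm c \in_s closure K HK c S).
rewrite (HS c (idm c) (closure K HK c S)); [exact I|].
rewrite pullback_idm; split; [|apply sub_closure].
apply (right_orth_anti _ _ DK), closure_right_orth.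
Qed.

Lemma left_right_orth_generated (D : sieve_collection C) :
  pullback_stable D -> is_generated_topology D (left_orth (right_orth D)).
Proof.
intros D_stable; constructor.
- apply left_orth_topology, right_orth_stable.
- apply sub_left_right_orth, D_stable.
- apply left_right_orth_least.
Qed.

Lemma generated_topology_unique (D J K : sieve_collection C) :
  is_generated_topology D J -> is_generated_topology D K ->
  forall (c : C) (S : sieve c), J c S <-> K c S.
Proof.
intros [tJ DJ minJ] [tK DK minK] c S.
split; [apply minJ | apply minK]; assumption.
Qed.

End Sieves.

Theorem mainTheorem3 (C : category) (D : sieve_collection C)
    (D_stable : pullback_stable D) :
  is_topology (left_orth D) /\
  is_generated_topology D (left_orth (right_orth D)) /\
  (forall J : sieve_collection C, is_generated_topology D J ->
   forall (c : C) (S : sieve c),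
     J c S <->
     (forall (d : C) (f : Hom d c) (T : sieve d),
        pullback f S \sub_s T /\
        (forall (e : C) (g : Hom e d) (Z : sieve e),
           D e Z /\ Z \sub_s pullback g T -> g \in_s T) ->
        T = max_sieve d)).
Proof.
pose proof (left_right_orth_generated C D D_stable) as Hgen.
split; [apply left_orth_topology, D_stable|].
split; [exact Hgen|].
intros J HJ c S.
rewrite (generated_topology_unique C D J _ HJ Hgen).
(* The explicit condition is membership in (D^r)^l unfolded, with the two conjuncts swapped. *)
split; intros H d f T [H1 H2]; exact (H d f T (conj H2 H1)).
Qed.
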